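(* For every positive integer $n$, the map $\mathrm{prs}_{(2,1)}$ is injective on the set of partitions of $n$ (of length at least $2$).
   Context: A partition $\lambda=(\lambda_1,\dots,\lambda_\ell)$ of $n$ is a nonincreasing sequence of positive integers summing to $n$; $\ell$ is its length. For a partition $\lambda'$ (not the conjugate of $\lambda$), the Schur polynomial is $s_{\lambda'}(x_1,\dots,x_\ell)=\sum_T x^T$, the sum over all semistandard Young tableaux $T$ of shape $\lambda'$ with entries in $\{1,\dots,\ell\}$ (weakly increasing along rows, strictly increasing down columns), where $x^T=\prod_i x_i^{\alpha_i}$ and $\alpha_i$ is the number of entries of $T$ equal to $i$. For a partition $\lambda$ for which $s_{\lambda'}(\lambda_1,\dots,\lambda_\ell)$ is defined and nonzero (equivalently, $\ell$ is at least the length of $\lambda'$), $\mathrm{prs}_{\lambda'}(\lambda)$ is the partition whose parts are the summands of $s_{\lambda'}(\lambda_1,\dots,\lambda_\ell)$, one part for each tableau $T$ (so a monomial with coefficient $c$ contributes $c$ equal parts). In particular, $s_{(2,1)}(x_1,\dots,x_\ell)=\sum_{1\le i<j\le \ell}(x_i^2x_j+x_ix_j^2)+2\sum_{1\le i<j<k\le \ell}x_ix_jx_k$, and $\mathrm{prs}_{(2,1)}$ is defined on partitions of length at least $2$. *)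

(* Defs.v *)
From mathcomp Require Import all_boot.

Set Implicit Arguments.
Unset Strict Implicit.
Unset Printing Implicit Defensive.

Definition is_partition (lam : seq nat) : bool :=
  sorted geq lam && all (leq 1) lam.

Definition is_partition_of (n : nat) (lam : seq nat) : bool :=
  is_partition lam && (sumn lam == n).

(* The cells (i, j), with j < sh_i, of the Young diagram of sh, in English
   convention: row i lies above row i + 1. *)
Definition cell (sh : seq nat) : finType :=
  {i : 'I_(size sh) & 'I_(nth 0 sh i)}.

Definition cell_row (sh : seq nat) (c : cell sh) : nat := tag c.
Definition cell_col (sh : seq nat) (c : cell sh) : nat := tagged c.

(* Fillings of the diagram; entries and variables are numbered from 0, so that
   'I_l plays the role of {1, ..., l}. *)
Definition filling (sh : seq nat) (l : nat) : finType :=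
  {ffun cell sh -> 'I_l}.

Definition is_ssyt (sh : seq nat) (l : nat) (T : filling sh l) : bool :=
  [forall c : cell sh, forall d : cell sh,
     ((cell_row c == cell_row d) && (cell_col c < cell_col d) ==> (T c <= T d))
  && ((cell_col c == cell_col d) && (cell_row c < cell_row d) ==> (T c < T d))].

Definition ssyt (sh : seq nat) (l : nat) : {set filling sh l} :=
  [set T | is_ssyt T].

Definition content (sh : seq nat) (l : nat) (T : filling sh l) (i : 'I_l) : nat :=
  #|[set c : cell sh | T c == i]|.

(* The monomial x^T evaluated at x_i = lam_i. *)
Definition monomial_at (sh lam : seq nat) (T : filling sh (size lam)) : nat :=
  \prod_(i < size lam) nth 0 lam i ^ content T i.

(* The Schur polynomial s_sh(x_1, ..., x_l) evaluated at x = lam, l = size lam. *)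
Definition schur_at (sh lam : seq nat) : nat :=
  \sum_(T in ssyt sh (size lam)) monomial_at T.

(* One part per tableau, so equal summands give repeated parts.  When lam is
   shorter than sh there is no tableau and the value is the junk [::]. *)
Definition prs (sh lam : seq nat) : seq nat :=
  sort geq [seq monomial_at T | T <- enum (ssyt sh (size lam))].

Lemma sumn_prs (sh lam : seq nat) : sumn (prs sh lam) = schur_at sh lam.
Proof.
rewrite /prs (perm_sumn (permEl (perm_sort _ _))) sumnE big_map.
by rewrite /schur_at big_enum.
Qed.

Lemma prs_is_partition (sh lam : seq nat) :
  is_partition lam -> is_partition_of (schur_at sh lam) (prs sh lam).
Proof.
case/andP=> _ /all_nthP lam_gt0.
rewrite /is_partition_of sumn_prs eqxx andbT; apply/andP; split.
  by apply: sort_sorted => m n; exact: leq_total.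
rewrite all_sort; apply/allP => _ /mapP[T _ ->].
apply: prodn_gt0 => i; rewrite expn_gt0.
by rewrite (lam_gt0 0 i (ltn_ord i)).
Qed.

(* Main.v *)
Require Import Defs.
From mathcomp Require Import all_boot.
From mathcomp Require Import zify ring.

Set Implicit Arguments.
Unset Strict Implicit.
Unset Printing Implicit Defensive.

(** Let [p_k] be the [k]-th power sum of the parts of [lam].  The [k]-th powers
of the parts of [prs (2,1) lam] are the summands of [s_(2,1)] evaluated at the
[k]-th powers of the parts of [lam]; since [3 s_(2,1) = p_1^3 - p_3], their sum
[S_k] satisfies [p_k^3 = 3 S_k + p_(3k)] ([cube_power_sum]).  The partition
[prs (2,1) lam] determines every [S_k], so [p_k] determines [p_(3k)]; starting
from [p_1 = n], it determines [p_1, p_3, p_9, p_27, ...].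

Infinitely many power sums determine a multiset of positive integers
([power_sums_inj]): for large exponents the largest part dominates the sum of
all the others, so two multisets sharing these power sums have the same largest
part, which can be removed from both.

The identity [3 s_(2,1) = p_1^3 - p_3] comes from cyclic rotation.  A tableau of
shape [(2,1)] is a triple [(a, b, c)], with first row [a b] and second row [c],
such that [a <= b] and [a < c].  Among the three rotations of a triple whose
entries are not all equal, exactly one satisfies these inequalities. *)

(** * Power sums determine a multiset *)

Definition power_sum (k : nat) (s : seq nat) : nat := \sum_(x <- s) x ^ k.

Lemma power_sum_cons k x s : power_sum k (x :: s) = x ^ k + power_sum k s.
Proof. by rewrite /power_sum big_cons. Qed.

Lemma power_sum1 s : power_sum 1 s = sumn s.
Proof. by rewrite sumnE; apply: eq_bigr => x _; rewrite expn1. Qed.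

(** Bernoulli's inequality for [(1 + 1/b)^k], cleared of fractions. *)
Lemma bernoulli b k : b ^ k * (b + k) <= b * b.+1 ^ k.
Proof.
elim: k => [|k IHk]; first by rewrite !expn0; lia.
by rewrite !expnS; nia.
Qed.

Lemma power_sum_le b k s : all (geq b) s -> power_sum k s <= size s * b ^ k.
Proof.
elim: s => [|x s IHs] /=; first by rewrite /power_sum big_nil.
case/andP=> le_xb /IHs {IHs}; rewrite power_sum_cons mulSn; apply: leq_add.
by elim: k => // k IHk; rewrite !expnS leq_mul.
Qed.

(** Exponential growth with a larger base wins over the number of terms.  For
[0 < b], Bernoulli's inequality bounds [(b + 1)^k] below by [b^k (1 + k / b)],
and the threshold on [k] makes [k / b] exceed the number of terms. *)
Lemma power_sum_lt a b s k :
  b < a -> all (geq b) s -> size s * b < k -> power_sum k s < a ^ k.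
Proof.
move=> lt_ba le_sb lt_k; have k_gt0 : 0 < k by apply: leq_ltn_trans lt_k.
have /leq_ltn_trans-> // := power_sum_le k le_sb.
have le_a : b.+1 ^ k <= a ^ k by rewrite leq_exp2r.
apply: leq_trans le_a; case: b {lt_ba le_sb} lt_k => [|b] lt_k.
  by rewrite exp0n // muln0 exp1n.
have := bernoulli b.+1 k.
have : 0 < b.+1 ^ k by rewrite expn_gt0.
by nia.
Qed.

(** At a large enough common exponent, a larger head would exceed the whole
other sum. *)
Lemma power_sum_head_le a s b t :
  path geq b t ->
  (forall N, exists2 k, N < k & power_sum k (a :: s) = power_sum k (b :: t)) ->
  a <= b.
Proof.
move=> sort_t eq_st; rewrite leqNgt; apply/negP => lt_ba.
have [k lt_k eq_k] := eq_st (size (b :: t) * b).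
have geq_trans : transitive geq by move=> y x z; lia.
have le_tb : all (geq b) (b :: t).
  by rewrite /= leqnn (order_path_min geq_trans).
have := power_sum_lt lt_ba le_tb lt_k.
by rewrite -eq_k power_sum_cons; lia.
Qed.

Lemma power_sums_inj (s t : seq nat) :
  is_partition s -> is_partition t ->
  (forall N, exists2 k, N < k & power_sum k s = power_sum k t) -> s = t.
Proof.
have nil_cons b u : is_partition (b :: u) ->
    (forall N, exists2 k, N < k & power_sum k [::] = power_sum k (b :: u)) ->
    False.
  case/andP=> _ /andP[b_gt0 _] /(_ 0)[k _].
  have : 0 < b ^ k by rewrite expn_gt0 b_gt0.
  by rewrite power_sum_cons {1}/power_sum big_nil; lia.
elim: s t => [|a s IHs] [|b t] // part_s part_t eq_st.
- by case: (nil_cons b t).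
- case: (nil_cons a s) => // N; have [k lt_k eq_k] := eq_st N.
  by exists k.
- have /andP[sort_s /andP[_ pos_s]] := part_s.
  have /andP[sort_t /andP[_ pos_t]] := part_t.
  have eq_ab : a = b.
    apply/eqP; rewrite eqn_leq (power_sum_head_le sort_t eq_st) /=.
    apply: (power_sum_head_le (s := t) sort_s) => N.
    by have [k lt_k eq_k] := eq_st N; exists k.
  rewrite eq_ab; congr (_ :: _); apply: IHs.
  + apply/andP; split; [exact: path_sorted sort_s | exact: pos_s].
  + apply/andP; split; [exact: path_sorted sort_t | exact: pos_t].
  + move=> N; have [k lt_k] := eq_st N.
    by rewrite !power_sum_cons eq_ab => /addnI; exists k.
Qed.

(** * Tableaux of shape (2,1) *)

(** Grouping the cells by their entry turns the exponents of the monomial into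
repeated factors. *)
Lemma monomial_atE (sh lam : seq nat) (T : filling sh (size lam)) :
  monomial_at T = \prod_(c : cell sh) nth 0 lam (T c).
Proof.
rewrite (partition_big (fun c => T c) xpredT) //=; apply: eq_bigr => i _.
rewrite (eq_bigr (fun=> nth 0 lam i)); last by move=> c /eqP->.
by rewrite prod_nat_const /content cardsE.
Qed.

(** The bounds are spelled as boolean proofs, so that any cell reduces to one of
the three below by irrelevance of these proofs. *)
Definition hook_cell i (lt_i : i < 2) j (lt_j : j < nth 0 [:: 2; 1] i) :
    cell [:: 2; 1] :=
  existT (fun i : 'I_2 => 'I_(nth 0 [:: 2; 1] i)) (Ordinal lt_i) (Ordinal lt_j).

Definition hook_corner : cell [:: 2; 1] := @hook_cell 0 isT 0 isT.
Definition hook_arm : cell [:: 2; 1] := @hook_cell 0 isT 1 isT.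
Definition hook_leg : cell [:: 2; 1] := @hook_cell 1 isT 0 isT.

Variant hook_cell_spec : cell [:: 2; 1] -> Type :=
  | HookCorner : hook_cell_spec hook_corner
  | HookArm : hook_cell_spec hook_arm
  | HookLeg : hook_cell_spec hook_leg.

Lemma hook_cellP c : hook_cell_spec c.
Proof.
case: c => -[[|[|i]] lt_i] //; rewrite (bool_irrelevance lt_i isT).
- case=> -[|[|j]] lt_j //; rewrite (bool_irrelevance lt_j isT).
  + exact: HookCorner.
  + exact: HookArm.
- case=> -[|j] lt_j //; rewrite (bool_irrelevance lt_j isT).
  exact: HookLeg.
Qed.

Lemma hook_cells_uniq : uniq [:: hook_corner; hook_arm; hook_leg].
Proof.
by apply: (map_uniq (f := fun c => (cell_row c, cell_col c))).
Qed.

Lemma hook_cells_perm :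
  perm_eq (index_enum (cell [:: 2; 1])) [:: hook_corner; hook_arm; hook_leg].
Proof.
apply: uniq_perm; rewrite ?index_enum_uniq ?hook_cells_uniq // => c.
by rewrite mem_index_enum; case: (hook_cellP c); rewrite !inE eqxx ?orbT.
Qed.

Lemma big_hook (F : cell [:: 2; 1] -> nat) :
  \prod_c F c = F hook_corner * F hook_arm * F hook_leg.
Proof.
by rewrite (perm_big _ hook_cells_perm) !big_cons big_nil /= muln1 mulnA.
Qed.

Definition hook_filling l (t : 'I_l * 'I_l * 'I_l) : filling [:: 2; 1] l :=
  [ffun c => if cell_row c == 1 then t.2
             else if cell_col c == 1 then t.1.2 else t.1.1].

Definition hook_triple l (T : filling [:: 2; 1] l) : 'I_l * 'I_l * 'I_l :=
  (T hook_corner, T hook_arm, T hook_leg).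

Lemma hook_tripleK l : cancel (@hook_triple l) (@hook_filling l).
Proof. by move=> T; apply/ffunP=> c; rewrite ffunE; case: (hook_cellP c). Qed.

Lemma hook_fillingK l : cancel (@hook_filling l) (@hook_triple l).
Proof. by move=> [[a b] c]; rewrite /hook_triple !ffunE. Qed.

Lemma is_ssyt_hook l (T : filling [:: 2; 1] l) :
  is_ssyt T = (T hook_corner <= T hook_arm) && (T hook_corner < T hook_leg).
Proof.
apply/forallP/andP => [ssT | [le_arm lt_leg] c].
  have /forallP/(_ hook_arm)/andP[/= row _] := ssT hook_corner.
  by have /forallP/(_ hook_leg)/andP[_ /= col] := ssT hook_corner.
apply/forallP => d.
by case: (hook_cellP c); case: (hook_cellP d); rewrite /= ?le_arm ?lt_leg.
Qed.

(** * The cube of a power sum *)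

(** The first three summands are the indicators of the tableau inequalities on
the three rotations of [(a, b, c)]: a minimal entry is in first position, and
ties between two minimal entries are broken by the strict inequality. *)
Lemma rotation_count (a b c : nat) :
  ((a <= b) && (a < c)) + ((b <= c) && (b < a)) + ((c <= a) && (c < b))
  + ((a == b) && (a == c)) = 1.
Proof. by lia. Qed.

Section TripleSum.

Variables (l : nat) (f : 'I_l -> nat).

Let sum3 (P : 'I_l -> 'I_l -> 'I_l -> nat) :=
  \sum_a \sum_b \sum_c P a b c * (f a * f b * f c).

Let sum3_rot P : sum3 (fun a b c => P b c a) = sum3 P.
Proof.
rewrite /sum3 exchange_big; apply: eq_bigr => b _; rewrite exchange_big.
by apply: eq_bigr => c _; apply: eq_bigr => a _; congr (_ * _); ring.
Qed.

Let sum3D P Q : sum3 (fun a b c => P a b c + Q a b c) = sum3 P + sum3 Q.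
Proof.
rewrite /sum3 -big_split; apply: eq_bigr => a _; rewrite -big_split.
apply: eq_bigr => b _; rewrite -big_split.
by apply: eq_bigr => c _; rewrite mulnDl.
Qed.

(** Expanding the cube gives a sum over all triples, with a weight that rotation
preserves; so the three rotated indicators of [rotation_count] contribute
equally, and the diagonal contributes the sum of cubes. *)
Lemma cube_sum :
  (\sum_a f a) ^ 3
  = 3 * (\sum_(a < l) \sum_(b < l) \sum_(c < l)
           ((a <= b) && (a < c)) * (f a * f b * f c))
    + \sum_a f a ^ 3.
Proof.
pose hook (a b c : 'I_l) : nat := (a <= b) && (a < c).
pose diag (a b c : 'I_l) : nat := ((a : nat) == b) && ((a : nat) == c).
have cubeE : (\sum_a f a) ^ 3 = sum3 (fun _ _ _ => 1).
  rewrite !expnS expn0 muln1 /sum3 big_distrl; apply: eq_bigr => a _ /=.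
  rewrite big_distrl big_distrr /=; apply: eq_bigr => b _.
  rewrite !big_distrr /=; apply: eq_bigr => c _.
  by ring.
have diagE : sum3 diag = \sum_a f a ^ 3.
  apply: eq_bigr => a _; rewrite (bigD1 a) //= (bigD1 a) //=.
  rewrite /diag eqxx mul1n big1 => [|c ne_ca]; last first.
    by rewrite eq_sym (negPf (ne_ca : (c : nat) != a)).
  rewrite big1 => [|b ne_ba]; first by ring.
  by rewrite big1 // => c _; rewrite eq_sym (negPf (ne_ba : (b : nat) != a)).
have splitE : sum3 (fun _ _ _ => 1)
    = sum3 (fun a b c => hook a b c + hook b c a + hook c a b + diag a b c).
  rewrite /sum3; do 3!(apply: eq_bigr => ? _).
  by rewrite /hook /diag rotation_count.
rewrite cubeE splitE !sum3D -diagE (sum3_rot hook).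
by rewrite (sum3_rot (fun a b c => hook b c a)) (sum3_rot hook) /sum3 /hook; ring.
Qed.

End TripleSum.

Lemma power_sum_prs_hook k (lam : seq nat)
    (f := fun i : 'I_(size lam) => nth 0 lam i ^ k) :
  power_sum k (prs [:: 2; 1] lam)
  = \sum_(a < size lam) \sum_(b < size lam) \sum_(c < size lam)
      ((a <= b) && (a < c)) * (f a * f b * f c).
Proof.
rewrite /power_sum /prs (perm_big _ (permEl (perm_sort _ _))) big_map /=.
rewrite big_enum /= big_mkcond /=.
rewrite (reindex (@hook_filling (size lam))) /=; last first.
  by exists (@hook_triple _) => t _; rewrite ?hook_fillingK ?hook_tripleK.
rewrite pair_bigA pair_bigA /=; apply: eq_bigr => -[[a b] c] _ /=.
rewrite inE is_ssyt_hook monomial_atE big_hook !ffunE /= !expnMn.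
by case: ifP; rewrite ?mul1n.
Qed.

(** This is [p_1^3 = 3 s_(2,1) + p_3], evaluated at the [k]-th powers of the
parts of [lam]. *)
Lemma cube_power_sum k (lam : seq nat) :
  power_sum k lam ^ 3
  = 3 * power_sum k (prs [:: 2; 1] lam) + power_sum (3 * k) lam.
Proof.
have power_sumE m : power_sum m lam = \sum_(i < size lam) nth 0 lam i ^ m.
  by rewrite /power_sum (big_nth 0) big_mkord.
rewrite power_sum_prs_hook !power_sumE (cube_sum (fun i => nth 0 lam i ^ k)).
by congr addn; apply: eq_bigr => i _; rewrite -expnM mulnC.
Qed.

Theorem theorem1p7 (n : nat) (n_gt0 : 0 < n) :
  {in [pred lam : seq nat | is_partition_of n lam && (1 < size lam)] &,
   injective (prs [:: 2; 1])}.
Proof.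
move=> lam mu /andP[/andP[part_lam /eqP sum_lam] _].
case/andP=> /andP[part_mu /eqP sum_mu] _ eq_prs.
have eq_pow j : power_sum (3 ^ j) lam = power_sum (3 ^ j) mu.
  elim: j => [|j IHj].
    by rewrite expn0 !power_sum1 sum_lam sum_mu.
  have := cube_power_sum (3 ^ j) lam.
  rewrite eq_prs IHj cube_power_sum -expnS.
  by move/addnI.
apply: power_sums_inj => // N.
by exists (3 ^ N); first exact: ltn_expl.
Qed.
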